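(* Let $X$ and $Y$ be real Hilbert spaces, let $e\in X$ and $f\in Y$, let $\mathcal{H}$ be the real Hilbert space of Hilbert-Schmidt operators from $X$ to $Y$, and let $\mathcal{A}\colon\mathcal{H}\to Y\times X$, $T\mapsto (Te,T^*f)$. Let $(s,r)\in Y\times X$ and set $(\bar{s},\bar{r}) := P_{\operatorname{ran}\mathcal{A}}(s,r)$. Then $$C := \mathcal{A}^{-1}(\bar{s},\bar{r}) = \{T\in\mathcal{H} : Te=\bar{s}\text{ and }T^*f=\bar{r}\}\neq\varnothing.$$ Let $T\in\mathcal{H}$. If $e\neq 0$ and $f\neq 0$, then $$P_C(T) = T - \frac{1}{\|e\|^2}\Big((Te-s)\otimes e - \frac{\langle f,Te-s\rangle}{\|e\|^2+\|f\|^2}\, f\otimes e\Big) - \frac{1}{\|f\|^2}\Big(f\otimes(T^*f-r) - \frac{\langle e,T^*f-r\rangle}{\|e\|^2+\|f\|^2}\, f\otimes e\Big).$$ Moreover, $$P_C(T)=\begin{cases} T-\dfrac{1}{\|f\|^2}\, f\otimes(T^*f-r), & \text{if } e=0 \text{ and } f\neq 0;\\[2mm] T-\dfrac{1}{\|e\|^2}\,(Te-s)\otimes e, & \text{if } e\neq 0\text{ and } f=0;\\[2mm] T, & \text{if } e=0\text{ and } f=0.\end{cases}$$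
   Context: $\mathcal{H}$ carries the Hilbert-Schmidt inner product $\langle T,S\rangle=\sum_{b\in B}\langle Tb,Sb\rangle$, where $B$ is any orthonormal basis of $X$. $Y\times X$ carries the product inner product $\langle (y,x),(v,u)\rangle=\langle y,v\rangle+\langle x,u\rangle$. For $(v,u)\in Y\times X$, the rank-one operator $v\otimes u\in\mathcal{H}$ is defined by $(v\otimes u)(x)=\langle u,x\rangle v$ for $x\in X$. $T^*$ is the adjoint of $T$. For a nonempty closed convex subset $D$ of a Hilbert space, $P_D$ denotes the orthogonal (nearest-point) projection onto $D$. The range $\operatorname{ran}\mathcal{A}$ is a closed linear subspace of $Y\times X$. *)

(* Defs.v *)
From HB Require Import structures.
From mathcomp Require Import all_boot all_order all_algebra sesquilinear.
From mathcomp Require Import boolp classical_sets functions reals ereal.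
From mathcomp Require Import topology normedtype numfun esum.

Set Implicit Arguments.
Unset Strict Implicit.
Unset Printing Implicit Defensive.

Import Order.TTheory GRing.Theory Num.Theory.
Import numFieldNormedType.Exports.

Local Open Scope classical_set_scope.
Local Open Scope ring_scope.

HB.mixin Record CompleteNormedModule_isHilbert (R : realType) (H : Type)
    of CompleteNormedModule R H := {
  inner : {dot H for (@idfun R)};
  inner_normE : forall x : H, inner x x = `|x| ^+ 2
}.

#[short(type="hilbertType")]
HB.structure Definition Hilbert (R : realType) :=
  {H of CompleteNormedModule_isHilbert R H & CompleteNormedModule R H}.

Section Projection.
Variables (R : realType) (V : zmodType) (ip : V -> V -> R).

Definition ipnorm (x : V) : R := Num.sqrt (ip x x).

Definition is_projection (D : set V) (x p : V) : Prop :=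
  D p /\ forall q, D q -> ipnorm (x - p) <= ipnorm (x - q).

(* Meaningful when a nearest point exists and is unique, e.g. for D nonempty,
   closed and convex in a Hilbert space; the value is 0 if there is none. *)
Definition proj (D : set V) (x : V) : V := xget 0 (is_projection D x).

End Projection.

(* The norm of the library on Y * X is the max-norm, which does not come from
   an inner product; the distance on Y * X is therefore taken from this one. *)
Definition prod_inner (R : realType) (Y X : hilbertType R) (p q : Y * X) : R :=
  inner p.1 q.1 + inner p.2 q.2.

Definition linear_span (R : realType) (X : lmodType R) (B : set X) : set X :=
  [set x | exists n (a : 'I_n -> R) (v : 'I_n -> X),
    (forall i, B (v i)) /\ x = \sum_(i < n) a i *: v i].

Definition orthonormal_basis (R : realType) (X : hilbertType R) (B : set X) :=
  [/\ forall b, B b -> inner b b = 1,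
      forall b c, B b -> B c -> b <> c -> inner b c = 0 &
      closure (linear_span B) = [set: X]].

Section Operators.
Variables (R : realType) (X Y : hilbertType R).

(* For continuous linear T the vector x exists and is unique, by Riesz. *)
Definition adjoint (T : X -> Y) : Y -> X := fun y =>
  xget 0 [set x | forall z, inner (T z) y = inner z x].

Definition rank1 (v : Y) (u : X) : X -> Y := fun x => inner u x *: v.

Definition hilbert_schmidt (B : set X) : set (X -> Y) :=
  [set T | [/\ linear T, continuous T &
               (\esum_(b in B) (`|T b| ^+ 2)%:E < +oo)%E]].

(* The sum over B, possibly uncountable, of an absolutely summable family of
   reals: \esum is only meant for nonnegative families, hence the splitting
   into positive and negative parts. *)
Definition hs_inner (B : set X) (T S : X -> Y) : R :=
  let t b := (inner (T b) (S b))%:E in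
  fine (\esum_(b in B) t^\+ b - \esum_(b in B) t^\- b)%E.

End Operators.

(* Main.v *)
Require Import Defs.
From HB Require Import structures.
From mathcomp Require Import all_boot all_order all_algebra sesquilinear.
From mathcomp Require Import boolp classical_sets functions cardinality fsbigop.
From mathcomp Require Import reals ereal topology normedtype numfun esum.
From mathcomp Require Import finmap sequences.
From mathcomp Require Import ring lra.

(** Rank-one operators represent the two evaluations that make up the map
    A : T |-> (T e, T^* f): for every Hilbert-Schmidt operator S,
      <v (x) u, S>_HS = <v, S u>      (has_sum_rank1),
    which is Parseval's identity applied to u and S^* v. Hence any operator of
    the form v (x) e + f (x) u is orthogonal to the kernel of A, because
      <v (x) e + f (x) u, S>_HS = <v, S e> + <f, S u> = <v, S e> + <S^* f, u>.
    So if P = T - (v (x) e + f (x) u) lies in the fibre C, then T - P is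
    orthogonal to all differences of elements of C, and by Pythagoras P is the
    unique nearest point of C to T (hs_projection). It only remains to exhibit
    v and u.

    The same principle in Y * X identifies (sbar, rbar). Since
    <T e, f> = <e, T^* f>, the range of A lies in the orthogonal complement of
    (f, -e), and for nonzero e and f the point
      (s, r) - c (f, -e)  with  c = (<f, s> - <e, r>) / (|e|^2 + |f|^2)
    is the projection as soon as it is attained. It is attained by the very
    operators P above: with
      v = |e|^-2 (T e - s - a f),       a = <f, T e - s> / (|e|^2 + |f|^2),
      u = |f|^-2 (T^* f - r - b e),     b = <e, T^* f - r> / (|e|^2 + |f|^2),
    one computes A P = (s, r) - c (f, -e) for every T. Thus a single computation
    shows that C is nonempty, that (sbar, rbar) is what it should be, and that
    P is the projection of T. With the convention 1/0 = 0 the formulas for v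
    and u remain correct when e or f vanishes, the corresponding component of
    (sbar, rbar) being then 0.

    Three analytic facts support this. Adjoints exist by the Riesz
    representation theorem, proved by minimising |x|^2 / 2 - phi x. Parseval's
    identity holds for an arbitrary, possibly uncountable, orthonormal basis,
    from Bessel's identity on finite subsets and density of the span. Finally
    the sum defining the Hilbert-Schmidt inner product, a difference of two
    extended-real sums, is additive; this is handled through the relation
    has_sum. *)

Set Implicit Arguments.
Unset Strict Implicit.
Unset Printing Implicit Defensive.

Import Order.TTheory GRing.Theory Num.Theory.
Import numFieldNormedType.Exports.

Local Open Scope classical_set_scope.
Local Open Scope ring_scope.

(** * Inner products and bounded linear maps *)

Section InnerProduct.
Variables (R : realType) (X : hilbertType R).
Implicit Types x y z : X.

Lemma innerDl x y z : inner (x + y) z = inner x z + inner y z.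
Proof. exact: linearDl. Qed.

Lemma innerNl x z : inner (- x) z = - inner x z.
Proof. exact: linearNl. Qed.

Lemma innerZl a x z : inner (a *: x) z = a * inner x z.
Proof. exact: linearZl_LR. Qed.

Lemma innerC x y : inner x y = inner y x.
Proof. by rewrite hermC expr0 mul1r. Qed.

Lemma innerDr x y z : inner z (x + y) = inner z x + inner z y.
Proof. exact: linearDr. Qed.

Lemma innerNr x z : inner z (- x) = - inner z x.
Proof. exact: linearNr. Qed.

Lemma innerZr a x z : inner z (a *: x) = a * inner z x.
Proof. exact: linearZr_LR. Qed.

Lemma inner0l x : inner 0 x = 0.
Proof. exact: linear0l. Qed.

Lemma inner0r x : inner x 0 = 0.
Proof. exact: linear0r. Qed.

Lemma innerv_ge0 x : 0 <= inner x x.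
Proof. by rewrite inner_normE exprn_ge0. Qed.

Lemma innerv_eq0 x : inner x x = 0 -> x = 0.
Proof. by rewrite inner_normE => /eqP; rewrite sqrf_eq0 normr_eq0 => /eqP. Qed.

End InnerProduct.

Lemma cauchy_schwarz (R : realType) (X : hilbertType R) (x y : X) :
  `|inner x y| <= `|x| * `|y|.
Proof.
rewrite -ler_sqr ?nnegrE ?mulr_ge0 // exprMn real_normK ?num_real //.
rewrite -!inner_normE.
have [->|y0] := eqVneq y 0; first by rewrite !inner0r expr0n mulr0 lexx.
have := innerv_ge0 (inner y y *: x - inner x y *: y).
rewrite innerDl !innerDr !innerNl !innerNr !innerZl !innerZr (innerC y x).
have yy : 0 < inner y y.
  rewrite lt_neqAle innerv_ge0 andbT eq_sym.
  by apply/eqP => /innerv_eq0/eqP; exact/negP.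
move: (inner x y) (inner y y) (inner x x) yy => a b c b0 h.
have : 0 <= b * (c * b - a ^+ 2) by lra.
by rewrite pmulr_rge0 // subr_ge0.
Qed.

Lemma fun_linear_bounded (R : realType) (V W : normedModType R) (T : V -> W) :
  linear T -> continuous T -> exists M, forall x, `|T x| <= M * `|x|.
Proof.
move=> linT cT.
pose T' : {linear V -> W} := HB.pack T (GRing.isLinear.Build _ _ _ _ T linT).
have /linear_boundedP : bounded_near T' (nbhs (0 : V)).
  by apply: continuous_linear_bounded; exact: cT.
case=> M [_ /(_ (M + 1))]; rewrite ltrDl ltr01 => /(_ isT) h.
by exists (M + 1).
Qed.

Lemma fun_bounded_continuous (R : realType) (V W : normedModType R)
    (T : V -> W) M :
  linear T -> (forall x, `|T x| <= M * `|x|) -> continuous T.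
Proof.
move=> linT bT.
pose T' : {linear V -> W} := HB.pack T (GRing.isLinear.Build _ _ _ _ T linT).
apply: (bounded_linear_continuous (f := T')).
apply/linear_boundedP; near=> r => x /=.
apply: le_trans (bT x) _; rewrite ler_wpM2r //.
rewrite ltW //; near: r; exact: nbhs_pinfty_gt (num_real _).
Unshelve. all: by end_near. Qed.

(** * Riesz representation and adjoints *)

(** The functional J x = |x|^2 / 2 - phi x is bounded below, and the
    parallelogram law makes its minimising sequences Cauchy. At the minimiser
    the derivative <z, x> - phi z vanishes in every direction z. *)
Lemma riesz (R : realType) (X : hilbertType R) (phi : X -> R) (M : R) :
  linear_for *%R phi -> (forall x, `|phi x| <= M * `|x|) ->
  exists x, forall z, phi z = inner z x.
Proof.
move=> linphi bphi.
have phiD x y : phi (x + y) = phi x + phi y.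
  by have := linphi 1 x y; rewrite scale1r mul1r.
have phi0 : phi 0 = 0 by have := phiD 0 0; rewrite addr0; lra.
have phiZ a x : phi (a *: x) = a * phi x.
  by have := linphi a x 0; rewrite !addr0 phi0 addr0.
have cphi : continuous phi.
  exact: (@fun_bounded_continuous _ _ R^o phi M linphi bphi).
pose J x := inner x x / 2 - phi x.
have J_ge x : - (M ^+ 2 / 2) <= J x.
  rewrite /J inner_normE; have := bphi x; have := ler_norm (phi x).
  move: (phi x) `|phi x| `|x| => a b c ab bc.
  suff : 0 <= (M - c) ^+ 2 by lra.
  exact: sqr_ge0.
pose m := inf (range J).
have infJ : has_inf (range J).
  split; first by exists (J 0), 0.
  by exists (- (M ^+ 2 / 2)) => _ [x _ <-].
have mJ x : m <= J x by apply: ge_inf; [exact: infJ.2 | exists x].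
have J_parallelogram x y : `|x - y| ^+ 2 <= 4 * (J x + J y - 2 * m).
  have := mJ ((2^-1) *: (x + y)); rewrite -inner_normE /J.
  rewrite phiZ phiD !(innerDl,innerDr,innerNl,innerNr,innerZl,innerZr).
  rewrite (innerC y x); lra.
have /choice[u uJ] : forall n : nat, exists x, J x < m + n.+1%:R^-1.
  move=> n; have [] := inf_adherent (eps := n.+1%:R^-1) _ infJ.
    by rewrite invr_gt0 ltr0n.
  by move=> _ [x _ <-] h; exists x.
have u_lim : J (u n) @[n --> \oo] --> m.
  apply: (@squeeze_cvgr _ _ _ _ (fun=> m) (fun n => m + n.+1%:R^-1)).
  - by near=> n; rewrite mJ /= ltW.
  - exact: cvg_cst.
  - rewrite -[X in _ --> X]addr0; apply: cvgD; first exact: cvg_cst.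
    exact: cvg_harmonic.
have cu : cvg (u n @[n --> \oo]).
  apply: cauchy_cvg; apply/cauchyP => eps eps0.
  (* Two values of J within eps^2 / 8 of m give |u N - u n|^2 < eps^2 in
     J_parallelogram. *)
  have e8 : 0 < eps ^+ 2 / 8 by rewrite divr_gt0 ?exprn_gt0.
  have /cvgrPdist_lt/(_ _ e8)[N _ hN] := u_lim.
  have JN n : (N <= n)%N -> J (u n) < m + eps ^+ 2 / 8.
    move=> /hN /=; have := mJ (u n); rewrite distrC => ?.
    by rewrite ger0_norm ?subr_ge0//; lra.
  exists (u N); exists N => // n /= Nn.
  rewrite -ball_normE /= -ltr_sqr ?nnegrE ?(ltW eps0)//.
  have := J_parallelogram (u N) (u n).
  have := JN _ Nn; have := JN _ (leqnn N); lra.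
have [x ux] := (cvg_ex _).1 cu.
have Jx : J x = m.
  apply: (cvg_unique _ _ u_lim) => //.
  have -> : (fun n => J (u n)) = (fun n => `|u n| ^+ 2 / 2 - phi (u n)).
    by apply/funext => n; rewrite /J inner_normE.
  rewrite /J inner_normE; apply: cvgB.
    apply: cvgMl; rewrite expr2; under eq_fun do rewrite expr2.
    by apply: cvgM; apply: cvg_norm.
  by apply: continuous_cvg => //; exact: cphi.
exists x => z; apply/esym/eqP; rewrite -subr_eq0; apply/eqP.
set d := _ - _.
(* J (x + t z) - J x = t d + t^2 |z|^2 / 2; the minimising t is - d / |z|^2, and
   |z|^2 + 1 in its place avoids the division by zero while still giving a
   negative value unless d = 0. *)
have := mJ (x + (- d / (inner z z + 1)) *: z).
rewrite -Jx /J phiD phiZ !(innerDl,innerDr,innerZl,innerZr) (innerC x z).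
have : 0 <= inner z z := innerv_ge0 z.
have -> : phi z = inner z x - d by rewrite /d; ring.
move: (inner z z) (inner z x) => N c N0 h.
have N1 : 0 < N + 1 by lra.
have : 0 <= - (d ^+ 2 * (N + 2)) / (2 * (N + 1) ^+ 2).
  have -> : - (d ^+ 2 * (N + 2)) / (2 * (N + 1) ^+ 2) =
    (- d / (N + 1)) * d + (- d / (N + 1)) ^+2 * N / 2 by field; rewrite gt_eqF.
  lra.
rewrite pmulr_lge0; last by rewrite invr_gt0 mulr_gt0 // exprn_gt0.
have : 0 <= d ^+ 2 := sqr_ge0 d.
move=> d0 h2; apply/eqP; rewrite -sqrf_eq0; apply/eqP.
nra.
Unshelve. all: by end_near. Qed.

Lemma inner_ext (R : realType) (X : hilbertType R) (x y : X) :
  (forall z, inner z x = inner z y) -> x = y.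
Proof.
move=> h; apply/eqP; rewrite -subr_eq0; apply/eqP/innerv_eq0.
by rewrite innerDr innerNr h subrr.
Qed.

Section Adjoint.
Variables (R : realType) (X Y : hilbertType R).

Lemma adjointP (T : X -> Y) y : linear T -> continuous T ->
  forall z, inner (T z) y = inner z (adjoint T y).
Proof.
move=> linT cT; have [M bT] := fun_linear_bounded linT cT.
apply: (xgetPex 0 (P := [set x | forall z, inner (T z) y = inner z x])).
apply: (@riesz _ _ (fun z => inner (T z) y) (M * `|y|)).
  by move=> a u v; rewrite linT innerDl innerZl.
move=> x; apply: (le_trans (cauchy_schwarz _ _)).
by rewrite mulrAC ler_wpM2r.
Qed.

Lemma adjoint_unique (T : X -> Y) y x :
  (forall z, inner (T z) y = inner z x) -> adjoint T y = x.
Proof.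
move=> h; apply: xget_unique => // x' h'; apply: inner_ext => z.
by rewrite -h -h'.
Qed.

End Adjoint.

(** * Unordered sums of real families *)

Section Sums.
Variables (R : realType) (T : choiceType) (B : set T).

(** The value of the sum does not depend on the decomposition g = a - b into
    nonnegative summable families (has_sumE); leaving a and b free, rather than
    taking the positive and negative parts of g, makes additivity immediate. *)
Definition has_sum (g : T -> R) (l : R) :=
  exists a b : T -> R, exists la lb : R,
  [/\ forall x, B x -> [/\ 0 <= a x, 0 <= b x & g x = a x - b x],
      (\esum_(x in B) (a x)%:E = la%:E)%E,
      (\esum_(x in B) (b x)%:E = lb%:E)%E & l = la - lb].

Lemma has_sumD g h lg lh : has_sum g lg -> has_sum h lh ->
  has_sum (fun x => g x + h x) (lg + lh).
Proof.
move=> [a [b [la [lb [abP sa sb ->]]]]] [c [d [lc [ld [cdP sc sd ->]]]]].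
exists (fun x => a x + c x), (fun x => b x + d x), (la + lc), (lb + ld); split.
- move=> x Bx; have [? ? ->] := abP x Bx; have [? ? ->] := cdP x Bx.
  by split; lra.
- under eq_esum do rewrite EFinD.
  rewrite esumD ?sa ?sc // => x Bx; rewrite lee_fin; first by case: (abP x Bx).
  by case: (cdP x Bx).
- under eq_esum do rewrite EFinD.
  rewrite esumD ?sb ?sd // => x Bx; rewrite lee_fin; first by case: (abP x Bx).
  by case: (cdP x Bx).
- lra.
Qed.

Lemma has_sumN g lg : has_sum g lg -> has_sum (fun x => - g x) (- lg).
Proof.
move=> [a [b [la [lb [abP sa sb ->]]]]]; exists b, a, lb, la; split => //.
  by move=> x Bx; have [? ? ->] := abP x Bx; split => //; lra.
lra.
Qed.

Lemma eq_has_sum g h l :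
  (forall x, B x -> g x = h x) -> has_sum g l -> has_sum h l.
Proof.
move=> gh [a [b [la [lb [abP sa sb ->]]]]]; exists a, b, la, lb.
split => // x Bx.
by have [? ? gE] := abP x Bx; rewrite -gh.
Qed.

Lemma esum_EFin_ge0 (g : T -> R) : (forall x, B x -> 0 <= g x) ->
  (0 <= \esum_(x in B) (g x)%:E)%E.
Proof. by move=> g0; apply: esum_ge0 => x /g0; rewrite lee_fin. Qed.

Lemma fin_esum (g : T -> R) : (forall x, B x -> 0 <= g x) ->
  (\esum_(x in B) (g x)%:E < +oo)%E ->
  (\esum_(x in B) (g x)%:E = (fine (\esum_(x in B) (g x)%:E))%:E)%E.
Proof. by move=> g0 goo; rewrite fineK // ge0_fin_numE // esum_EFin_ge0. Qed.

Lemma ge0_has_sum (g : T -> R) l : (forall x, B x -> 0 <= g x) ->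
  (\esum_(x in B) (g x)%:E = l%:E)%E -> has_sum g l.
Proof.
move=> g0 sg; exists g, (fun=> 0), l, 0; rewrite subr0.
split => //; last by rewrite esum1.
by move=> x /g0 ?; rewrite subr0.
Qed.

(** For g = a - b, the positive and negative parts of g satisfy
    g^+ + b = a + g^-, and g^+ <= a, g^- <= b; so all four sums are finite and
    the difference of the first two is that of a and b. *)
Lemma has_sumE g l : has_sum g l ->
  let t x := (g x)%:E in
  fine (\esum_(x in B) t^\+ x - \esum_(x in B) t^\- x)%E = l.
Proof.
move=> [a [b [la [lb [abP sa sb ->]]]]] t.
have tpE x : t^\+%E x = (Num.max (g x) 0)%:E by rewrite funeposE EFin_max.
have tnE x : t^\-%E x = (Num.max (- g x) 0)%:E by rewrite funenegE EFin_max.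
under eq_esum do rewrite tpE.
under [X in (_ - X)%E]eq_esum do rewrite tnE.
have p0 x : 0 <= Num.max (g x) 0 by rewrite le_max lexx orbT.
have n0 x : 0 <= Num.max (- g x) 0 by rewrite le_max lexx orbT.
have pE : (\esum_(x in B) (Num.max (g x) 0)%:E < +oo)%E.
  apply: (@le_lt_trans _ _ la%:E); last exact: ltry.
  rewrite -sa; apply: le_esum => x /abP[a0 b0 ->]; rewrite lee_fin ge_max; lra.
have nE : (\esum_(x in B) (Num.max (- g x) 0)%:E < +oo)%E.
  apply: (@le_lt_trans _ _ lb%:E); last exact: ltry.
  rewrite -sb; apply: le_esum => x /abP[a0 b0 ->]; rewrite lee_fin ge_max; lra.
have := fin_esum (fun x _ => p0 x) pE; have := fin_esum (fun x _ => n0 x) nE.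
move: (fine _) (fine _) => n p nn pp.
have : (\esum_(x in B) ((Num.max (g x) 0)%:E + (b x)%:E) =
        \esum_(x in B) ((a x)%:E + (Num.max (- g x) 0)%:E))%E.
  apply: eq_esum => x /abP[a0 b0 gE]; rewrite -!EFinD; congr EFin.
  by rewrite !maxEge; case: ifP; case: ifP; lra.
rewrite !esumD ?sa ?sb ?nn ?pp;
  try by [move=> x Bx; rewrite lee_fin; case: (abP x Bx)
         | move=> x _; rewrite lee_fin].
rewrite -!EFinD => -[]; rewrite /=; lra.
Qed.

End Sums.

(** * Parseval's identity *)

Section Parseval.
Variables (R : realType) (X : hilbertType R).

Lemma inner_lincombr (s : seq X) (a : X -> R) (z : X) :
  inner z (\sum_(b <- s) a b *: b) = \sum_(b <- s) a b * inner z b.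
Proof.
elim/big_rec2: _ => [|b x y _ <-]; first by rewrite inner0r.
by rewrite innerDr innerZr.
Qed.

Definition orth_proj (s : seq X) (u : X) := \sum_(b <- s) inner u b *: b.

Variables (B : set X) (B_basis : orthonormal_basis B).

Lemma orth_proj_perp (s : seq X) u c : uniq s -> {subset s <= B} -> c \in s ->
  inner c (u - orth_proj s u) = 0.
Proof.
move=> us sB cs; have [n1 n0 _] := B_basis.
rewrite innerDr innerNr inner_lincombr (bigD1_seq c) //= big1_seq ?addr0.
  by rewrite n1 ?mulr1 1?innerC ?subrr //; exact/set_mem/sB.
move=> b /andP[bc bs]; rewrite (n0 c b) ?mulr0 //; try exact/set_mem/sB.
by move=> cb; rewrite cb eqxx in bc.
Qed.

Lemma bessel_identity (s : seq X) u : uniq s -> {subset s <= B} ->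
  inner (u - orth_proj s u) (u - orth_proj s u) =
  inner u u - \sum_(b <- s) inner u b ^+ 2.
Proof.
move=> us sB.
have pp : inner (u - orth_proj s u) (orth_proj s u) = 0.
  rewrite inner_lincombr big1_seq // => b bs.
  by rewrite [X in _ * X]innerC orth_proj_perp // mulr0.
rewrite {1}[u - orth_proj s u]lock innerDr innerNr -lock pp oppr0 addr0.
rewrite innerDl innerNl [inner (orth_proj s u) u]innerC inner_lincombr.
by congr (_ - _); apply: eq_bigr => b _; rewrite expr2.
Qed.

Lemma fset_sub_mem (F : set X) : finite_set F -> F `<=` B ->
  {subset (fset_set F : seq X) <= B}.
Proof. by move=> fF FB x; rewrite in_fset_set // => /set_mem/FB/mem_set. Qed.

(** Bessel's identity bounds every finite partial sum by |u|^2. Conversely, if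
    x in the span of B is within sqrt eps of u and F is the finite set of basis
    vectors that x involves, the projection of u on the span of F is at least
    as close to u as x, so the sum over F already exceeds |u|^2 - eps. *)
Lemma parseval u : (\esum_(b in B) (inner u b ^+ 2)%:E = (inner u u)%:E)%E.
Proof.
apply/eqP; rewrite eq_le; apply/andP; split.
  apply: ge_ereal_sup => _ [F [fF FB] <-].
  rewrite fsumEFin // fsbig_finite // lee_fin -subr_ge0.
  rewrite -bessel_identity; last first.
  - exact: fset_sub_mem.
  - exact: fset_uniq.
  exact: innerv_ge0.
apply/lee_addgt0Pr => eps eps0.
have [_ _ clB] := B_basis.
have : closure (linear_span B) u by rewrite clB.
move=> /(_ _ (nbhsx_ballx u (Num.sqrt eps) _)); rewrite sqrtr_gt0 => /(_ eps0).
move=> [x [[n [a [v [vB xE]]]]]]; rewrite -ball_normE /= => ux.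
pose F := range v.
have fF : finite_set F by exact: finite_image.
have FB : F `<=` B by move=> _ [i _ <-].
have uF := fset_uniq (fset_set F); have sF := fset_sub_mem fF FB.
apply: (@le_trans _ _ ((\sum_(b \in F) (inner u b ^+ 2)%:E)%R + eps%:E)%E);
  last first.
  by rewrite leeD2r // esum_ge //; exists F.
rewrite fsumEFin // fsbig_finite // -EFinD lee_fin.
rewrite -lerBlDl -bessel_identity //.
set p := orth_proj _ u.
apply: (@le_trans _ _ (inner (u - x) (u - x))); last first.
  rewrite inner_normE -[leRHS]sqr_sqrtr ?(ltW eps0)//.
  by rewrite ler_sqr ?nnegrE ?sqrtr_ge0 // ltW.
have perp : inner (u - p) (p - x) = 0.
  have perpF c : c \in (fset_set F : seq X) -> inner (u - p) c = 0.
    by move=> cF; rewrite innerC orth_proj_perp.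
  rewrite innerDr innerNr inner_lincombr big1_seq ?sub0r => [|b bF]; last first.
    by rewrite perpF // mulr0.
  rewrite xE.
  have -> : inner (u - p) (\sum_(i < n) a i *: v i) =
      \sum_(i < n) a i * inner (u - p) (v i).
    elim/big_rec2: _ => [|b y z _ <-]; first by rewrite inner0r.
    by rewrite innerDr innerZr.
  rewrite big1 ?oppr0 // => i _; rewrite perpF ?mulr0 //.
  by rewrite in_fset_set //; apply/mem_set; exists i.
have -> : u - x = (u - p) + (p - x) by rewrite addrA subrK.
move: (u - p) (p - x) perp => g h perp.
rewrite innerDl !innerDr (innerC h g) perp addr0 add0r.
by rewrite lerDl innerv_ge0.
Qed.

(** Polarization of parseval. *)
Lemma parseval_inner u w :
  has_sum B (fun b => inner u b * inner w b) (inner u w).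
Proof.
have P x : has_sum B (fun b => inner x b ^+ 2) (inner x x).
  by apply: ge0_has_sum => [b _|]; [exact: sqr_ge0 | exact: parseval].
have := has_sumD (P (2^-1 *: (u + w))) (has_sumN (P (2^-1 *: (u - w)))).
have -> : inner (2^-1 *: (u + w)) (2^-1 *: (u + w)) -
  inner (2^-1 *: (u - w)) (2^-1 *: (u - w)) = inner u w.
  rewrite !(innerZl, innerZr, innerDl, innerDr, innerNl, innerNr) (innerC w u).
  by field.
apply: eq_has_sum => b _.
by rewrite !(innerZl, innerDl, innerNl); field.
Qed.

End Parseval.

(** * Nearest points *)

(** The identities are assumed only for differences of x, p and points of D,
    because the Hilbert-Schmidt inner product is bilinear and definite on the
    Hilbert-Schmidt operators but not on all of X -> Y. *)
Lemma proj_pythagoras (R : realType) (V : zmodType) (ip : V -> V -> R)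
    (D : set V) (x p : V) :
  D p -> 0 <= ip (x - p) (x - p) ->
  (forall q, D q ->
     ip (x - q) (x - q) = ip (x - p) (x - p) + ip (p - q) (p - q)) ->
  (forall q, D q -> 0 <= ip (p - q) (p - q)) ->
  (forall q, D q -> ip (p - q) (p - q) = 0 -> q = p) ->
  is_projection ip D x p /\ proj ip D x = p.
Proof.
move=> Dp xp0 pyth pq0 pq_eq0.
have proj_p : is_projection ip D x p.
  split=> // q Dq; rewrite /ipnorm ler_wsqrtr // (pyth q) // lerDl; exact: pq0.
split=> //; apply: xget_unique => // q [Dq /(_ _ Dp)].
rewrite /ipnorm ler_psqrt ?nnegrE // (pyth q) // ?addr_ge0 ?pq0 //.
rewrite gerDl => le0; apply: pq_eq0 => //.
by apply/eqP; rewrite eq_le le0 pq0.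
Qed.

Lemma prod_projection (R : realType) (X Y : hilbertType R) (D : set (Y * X))
    (x p : Y * X) : D p ->
  (forall q, D q -> prod_inner (x - p) (p - q) = 0) ->
  is_projection (@prod_inner R Y X) D x p /\ proj (@prod_inner R Y X) D x = p.
Proof.
have ge0 q : 0 <= prod_inner q q :> R by rewrite addr_ge0 // innerv_ge0.
move=> Dp perp; apply: proj_pythagoras => // q Dq.
- have := perp q Dq; rewrite -(subrKA p x (- q)).
  move: (x - p) (p - q) => g h; rewrite /prod_inner /=.
  rewrite !innerDl !innerDr (innerC h.1) (innerC h.2); lra.
- move=> /eqP; rewrite paddr_eq0 ?innerv_ge0 //.
  move=> /andP[/eqP/innerv_eq0 + /eqP/innerv_eq0].
  case: p q {Dp perp Dq} => [p1 p2] [q1 q2] /= /eqP + /eqP.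
  by rewrite !subr_eq0 => /eqP-> /eqP->.
Qed.

(** * Hilbert-Schmidt operators *)

Section HilbertSchmidt.
Variables (R : realType) (X Y : hilbertType R) (B : set X).
Hypothesis B_basis : orthonormal_basis B.
Implicit Types (T S : X -> Y).
Local Notation HS := (@hilbert_schmidt R X Y B).

Lemma hs_innerE T S l : has_sum B (fun b => inner (T b) (S b)) l ->
  hs_inner B T S = l.
Proof. exact: has_sumE. Qed.

Lemma HS_esum T : HS T ->
  (\esum_(b in B) (inner (T b) (T b))%:E = (hs_inner B T T)%:E)%E.
Proof.
move=> [_ _ sT].
have n0 b : B b -> 0 <= inner (T b) (T b) by rewrite innerv_ge0.
have sTE : (\esum_(b in B) (inner (T b) (T b))%:E < +oo)%E.
  by under eq_esum do rewrite inner_normE.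
have sumE := fin_esum n0 sTE.
by rewrite (hs_innerE (ge0_has_sum n0 sumE)).
Qed.

Lemma HS_has_sum T : HS T ->
  has_sum B (fun b => inner (T b) (T b)) (hs_inner B T T).
Proof.
by move=> hT; apply: ge0_has_sum (HS_esum hT) => b _; exact: innerv_ge0.
Qed.

Lemma hs_inner_ge0 T : HS T -> 0 <= hs_inner B T T.
Proof.
move=> hT; rewrite -lee_fin -HS_esum //.
by apply: esum_EFin_ge0 => b _; exact: innerv_ge0.
Qed.

Lemma HS_sub T S : HS T -> HS S -> HS (T - S).
Proof.
move=> [linT cT sT] [linS cS sS]; split.
- by move=> a x y; rewrite !fctE linT linS scalerBr opprD addrACA.
- by move=> x; apply: continuousB; [exact: cT | exact: cS].
(* |T b - S b|^2 <= 2 |T b|^2 + 2 |S b|^2 *)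
apply: (@le_lt_trans _ _
  ((\esum_(b in B) (`|T b| ^+ 2)%:E + \esum_(b in B) (`|T b| ^+ 2)%:E) +
   (\esum_(b in B) (`|S b| ^+ 2)%:E + \esum_(b in B) (`|S b| ^+ 2)%:E))%E);
  last first.
  by rewrite !lte_add_pinfty.
rewrite -!esumD; try by [move=> b _; rewrite ?adde_ge0 // lee_fin exprn_ge0].
apply: le_esum => b _; rewrite -!EFinD lee_fin !fctE -!inner_normE.
have := innerv_ge0 (T b + S b).
by rewrite !(innerDl,innerDr,innerNl,innerNr) (innerC (S b)); lra.
Qed.

Lemma HS_rank1 v u : HS (rank1 v u).
Proof.
have lin : linear (rank1 v u).
  by move=> a x y; rewrite /rank1 innerDr innerZr scalerDl scalerA.
split => //.
  apply: (@fun_bounded_continuous _ _ _ _ (`|u| * `|v|)) => // x.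
  by rewrite normrZ mulrAC ler_wpM2r // cauchy_schwarz.
rewrite (_ : esum _ _ = (inner (`|v| *: u) (`|v| *: u))%:E) ?ltry //.
rewrite -(parseval B_basis); apply: eq_esum => b _; congr EFin.
by rewrite normrZ exprMn real_normK ?num_real // innerZl exprMn mulrC.
Qed.

Lemma HS_adjointP S z : HS S -> forall x, inner (S x) z = inner x (adjoint S z).
Proof. by case=> ? ? _; exact: adjointP. Qed.

Lemma adjointB T S z : HS T -> HS S ->
  adjoint (T - S) z = adjoint T z - adjoint S z.
Proof.
move=> hT hS; apply: adjoint_unique => x.
by rewrite fctE innerDl innerNl !HS_adjointP // innerDr innerNr.
Qed.

(** Termwise <u, b> <v, S b> = <u, b> <S^* v, b>, so this is Parseval's identity
    for u and S^* v. *)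
Lemma has_sum_rank1 v u S : HS S ->
  has_sum B (fun b => inner (rank1 v u b) (S b)) (inner v (S u)).
Proof.
move=> hS; rewrite innerC HS_adjointP //.
apply: eq_has_sum (parseval_inner B_basis u (adjoint S v)) => b _.
by rewrite /rank1 innerZl [inner v _]innerC HS_adjointP // [inner b _]innerC.
Qed.

(** S vanishes on B, hence by has_sum_rank1 so does <S x, S x> for every x. *)
Lemma hs_inner_eq0 S : HS S -> hs_inner B S S = 0 -> S = 0.
Proof.
move=> hS S0.
have Sb b : B b -> S b = 0.
  move=> Bb; apply: innerv_eq0; apply/eqP; rewrite eq_le innerv_ge0 andbT.
  rewrite -lee_fin -[X in (_ <= X%:E)%E]S0 -HS_esum //; apply: esum_ge.
  exists [set b]; last by rewrite fsbig_set1.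
  by split; [exact: finite_set1 | move=> _ ->].
apply/funext => x; apply: innerv_eq0.
have has_sum0 : has_sum B (fun b => inner (rank1 (S x) x b) (S b)) 0.
  apply: (eq_has_sum (g := fun=> 0)) => [b Bb|].
    by rewrite (Sb b Bb) inner0r.
  by apply: ge0_has_sum => //; rewrite esum1.
by rewrite -(hs_innerE has_sum0) -(hs_innerE (has_sum_rank1 (S x) x hS)).
Qed.

(** Elements S of C agree with P at e and under the adjoint at f, so P - S is
    orthogonal to T - P = v (x) e + f (x) u. *)
Lemma hs_projection T v u (C : set (X -> Y)) (e : X) (f : Y) :
  let P := T - (rank1 v e + rank1 f u) in
  HS T -> C P -> C `<=` HS ->
  (forall S, C S -> S e = P e /\ adjoint S f = adjoint P f) ->
  is_projection (hs_inner B) C T P /\ proj (hs_inner B) C T = P.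
Proof.
move=> P hT CP CHS CA; have hP := CHS _ CP.
have hTP := HS_sub hT hP.
have TPE : T - P = rank1 v e + rank1 f u by rewrite /P subKr.
move: P TPE => P TPE in CP CA hP hTP *.
have hPS S : C S -> HS (P - S) by move=> /CHS; exact: HS_sub.
apply: proj_pythagoras => //.
- exact: hs_inner_ge0.
- move=> S inCS; have hS := CHS _ inCS; have [Se Sf] := CA S inCS.
  have perp : has_sum B (fun b => inner ((T - P) b) ((P - S) b)) 0.
    (* (P - S) e = 0, and <f, (P - S) u> = <(P - S)^* f, u> = 0. *)
    have -> : 0 = inner v ((P - S) e) + inner f ((P - S) u).
      have -> : (P - S) e = 0 by rewrite -[LHS]/(P e - S e) Se subrr.
      rewrite inner0r add0r innerC HS_adjointP //; last exact: hPS.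
      by rewrite adjointB // Sf subrr inner0r.
    have := has_sumD (has_sum_rank1 v e (hPS _ inCS))
                     (has_sum_rank1 f u (hPS _ inCS)).
    apply: eq_has_sum => b _.
    by rewrite TPE innerDl.
  have -> : hs_inner B (T - P) (T - P) + hs_inner B (P - S) (P - S) =
      hs_inner B (T - P) (T - P) + hs_inner B (P - S) (P - S) + (0 + 0).
    by rewrite !addr0.
  apply: hs_innerE.
  have := has_sumD (has_sumD (HS_has_sum hTP) (HS_has_sum (hPS _ inCS)))
                   (has_sumD perp perp).
  apply: eq_has_sum => b _.
  have -> : (T - S) b = (T - P) b + (P - S) b.
    by rewrite -[RHS]/((T - P + (P - S)) b) addrA subrK.
  move: ((T - P) b) ((P - S) b) => g h.
  by rewrite innerDl !innerDr (innerC h g); lra.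
- by move=> S inCS; apply: hs_inner_ge0; exact: hPS.
- move=> S inCS /hs_inner_eq0 -/(_ (hPS _ inCS)) /eqP.
  by rewrite subr_eq0 => /eqP ->.
Qed.

Lemma adjoint_corrected T v e f u : HS T ->
  adjoint (T - (rank1 v e + rank1 f u)) f =
  adjoint T f - (inner v f *: e + inner f f *: u).
Proof.
move=> hT; apply: adjoint_unique => z.
rewrite !fctE /rank1 innerDl innerNl innerDl !innerZl HS_adjointP //.
rewrite innerDr innerNr innerDr !innerZr ![inner z _]innerC; lra.
Qed.

Lemma HS_corrected T v e f u : HS T -> HS (T - (rank1 v e + rank1 f u)).
Proof.
by move=> hT; rewrite opprD addrA; do 2!(apply: HS_sub; last exact: HS_rank1).
Qed.

End HilbertSchmidt.

(** * The correction term and the projection onto the range *)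

Section Correction.
Variables (R : realType) (X Y : hilbertType R) (B : set X).
Hypothesis B_basis : orthonormal_basis B.
Variables (e : X) (f : Y) (s : Y) (r : X).
Implicit Types (T S : X -> Y).
Local Notation HS := (@hilbert_schmidt R X Y B).
Local Notation E := (`|e| ^+ 2).
Local Notation F := (`|f| ^+ 2).

Definition left_coef T := inner f (T e - s) / (E + F).
Definition right_coef T := inner e (adjoint T f - r) / (E + F).

(** These are chosen so that T - (left_corr (x) e + f (x) right_corr) lies in
    the fibre of (s_bar, r_bar). If e = 0 (or f = 0), left_corr (or right_corr)
    vanishes by the convention 1/0 = 0, and so does the rank-one operator it
    stands in. *)
Definition left_corr T : Y := E^-1 *: (T e - s - left_coef T *: f).
Definition right_corr T : X := F^-1 *: (adjoint T f - r - right_coef T *: e).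

(** The coordinate of (s, r) along (f, -e). *)
Definition mismatch := (inner f s - inner e r) / (E + F).

(** For nonzero e and f, (s_bar, r_bar) is the orthogonal projection of (s, r)
    on the complement of (f, -e). *)
Definition s_bar : Y := if e == 0 then 0 else s - mismatch *: f.
Definition r_bar : X := if f == 0 then 0 else r + mismatch *: e.

Lemma norm_sqr_gt0 (Z : hilbertType R) (z : Z) : z != 0 -> 0 < `|z| ^+ 2.
Proof. by move=> z0; rewrite exprn_gt0 // normr_gt0. Qed.

Lemma HS0 T : HS T -> T 0 = 0.
Proof.
by case=> linT _ _; have := linT (-1) 0 0; rewrite !scaleN1r oppr0 addr0 addNr.
Qed.

Lemma corrected_at_e T : HS T ->
  T e - (inner e e *: left_corr T + inner (right_corr T) e *: f) = s_bar.
Proof.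
move=> hT; rewrite /s_bar; case: eqVneq => [e0|/norm_sqr_gt0 E0].
  by rewrite /left_corr e0 (HS0 hT) inner0l inner0r !scale0r addr0 subrr.
rewrite inner_normE {1}/left_corr scalerA divff ?gt_eqF // scale1r.
rewrite !opprD !opprK !addrA subrr add0r -addrA -scalerBl -scaleNr.
congr (_ + _).
have [->|/norm_sqr_gt0 F0] := eqVneq f 0; first by rewrite !scaler0.
congr (_ *: _).
rewrite /right_corr /left_coef /right_coef /mismatch.
rewrite !(innerZl,innerDl,innerNl,innerDr,innerNr) inner_normE.
rewrite (innerC f (T e)) (HS_adjointP _ hT) ![inner _ e]innerC.
by field; rewrite gt_eqF ?addr_gt0 // -sqrf_eq0 gt_eqF.
Qed.

Lemma corrected_at_f T : HS T ->
  adjoint T f - (inner (left_corr T) f *: e + inner f f *: right_corr T) =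
  r_bar.
Proof.
move=> hT; rewrite /r_bar addrC; case: eqVneq => [f0|/norm_sqr_gt0 F0].
  rewrite f0 inner0l inner0r !scale0r addr0 oppr0 add0r.
  by apply: adjoint_unique => z; rewrite !inner0r.
rewrite inner_normE {1}/right_corr scalerA divff ?gt_eqF // scale1r.
rewrite addrC [X in _ - X]addrC.
rewrite !opprD !opprK !addrA subrr add0r -addrA -scalerBl; congr (_ + _).
have [->|/norm_sqr_gt0 E0] := eqVneq e 0; first by rewrite !scaler0.
congr (_ *: _).
rewrite /left_corr /left_coef /right_coef /mismatch.
rewrite !(innerZl,innerDl,innerNl,innerDr,innerNr) inner_normE.
rewrite (innerC f (T e)) (innerC s f) (HS_adjointP _ hT).
by field; rewrite gt_eqF ?addr_gt0 // -sqrf_eq0 gt_eqF.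
Qed.

(** For nonzero e and f the residual is a multiple of (f, -e), and
    <f, S e> = <S^* f, e>. If e = 0, the first component of the residual is s,
    which need not vanish, but S e does; likewise for f. *)
Lemma residual_perp S : HS S ->
  inner (s - s_bar) (S e) + inner (r - r_bar) (adjoint S f) = 0.
Proof.
move=> hS; rewrite /s_bar /r_bar.
have adj0 z : z = 0 -> adjoint S z = 0.
  by move=> ->; apply: adjoint_unique => x; rewrite !inner0r.
have [e0|e0] := eqVneq e 0; have [f0|f0] := eqVneq f 0.
- by rewrite e0 (HS0 hS) adj0 // !inner0r addr0.
- by rewrite e0 (HS0 hS) inner0r scaler0 addr0 subrr inner0l addr0.
- by rewrite adj0 // inner0r f0 scaler0 subr0 subrr inner0l addr0.
- rewrite subKr opprD addrA subrr sub0r innerNl !innerZl.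
  by rewrite [inner f _]innerC (HS_adjointP _ hS) subrr.
Qed.

Lemma corrected_formula T :
  T - (rank1 (left_corr T) e + rank1 f (right_corr T)) =
  T - E^-1 *: (rank1 (T e - s) e - left_coef T *: rank1 f e)
    - F^-1 *: (rank1 f (adjoint T f - r) - right_coef T *: rank1 f e).
Proof.
rewrite opprD addrA; apply/funext => z.
rewrite !fctE /rank1 /left_corr /right_corr.
congr (_ - _ - _).
  rewrite scalerA mulrC -scalerA; congr (_ *: _).
  by rewrite scalerBr !scalerA mulrC.
rewrite innerZl -scalerA; congr (_ *: _).
by rewrite innerDl innerNl innerZl scalerBl scalerA.
Qed.

End Correction.

(** * The projection onto the fibre *)

Theorem theorem2p8 (R : realType) (X Y : hilbertType R)
    (B : set X) (B_basis : orthonormal_basis B)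
    (e : X) (f : Y) (s : Y) (r : X) :
  let HS : set (X -> Y) := hilbert_schmidt B in
  let A (T : X -> Y) : Y * X := (T e, adjoint T f) in
  let ranA : set (Y * X) := A @` HS in
  let sbar : Y := (proj (@prod_inner R Y X) ranA (s, r)).1 in
  let rbar : X := (proj (@prod_inner R Y X) ranA (s, r)).2 in
  let C : set (X -> Y) := HS `&` A @^-1` [set (sbar, rbar)] in
  let PC (T : X -> Y) : X -> Y := proj (@hs_inner R X Y B) C T in
  [/\ is_projection (@prod_inner R Y X) ranA (s, r) (sbar, rbar),
      C = [set T | HS T /\ (T e = sbar /\ adjoint T f = rbar)],
      C !=set0 &
      forall T : X -> Y, HS T ->
      [/\ is_projection (@hs_inner R X Y B) C T (PC T),
          e <> 0 -> f <> 0 ->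
          PC T = T
            - (`|e| ^+ 2)^-1 *:
                (rank1 (T e - s) e
                 - (inner f (T e - s) / (`|e| ^+ 2 + `|f| ^+ 2)) *: rank1 f e)
            - (`|f| ^+ 2)^-1 *:
                (rank1 f (adjoint T f - r)
                 - (inner e (adjoint T f - r) / (`|e| ^+ 2 + `|f| ^+ 2))
                     *: rank1 f e),
          e = 0 -> f <> 0 ->
          PC T = T - (`|f| ^+ 2)^-1 *: rank1 f (adjoint T f - r),
          e <> 0 -> f = 0 ->
          PC T = T - (`|e| ^+ 2)^-1 *: rank1 (T e - s) e &
          e = 0 -> f = 0 -> PC T = T]].
Proof.
move=> HS A ranA sbar rbar C PC.
pose y := s_bar e f s r; pose x := r_bar e f s r.
pose P T := T - (rank1 (left_corr e f s T) e + rank1 f (right_corr e f r T)).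
have HS_P T : HS T -> HS (P T) by exact: HS_corrected.
have A_P T : HS T -> A (P T) = (y, x).
  move=> hT; rewrite /A [adjoint (P T) f](adjoint_corrected (B := B)) //.
  rewrite (corrected_at_f e f s r hT).
  by congr (_, _); exact: corrected_at_e hT.
(* The zero operator, any element of HS serving to show that C is nonempty. *)
have HS00 : HS (rank1 0 0) := HS_rank1 B_basis 0 0.
have [proj_yx projE] : is_projection (@prod_inner R Y X) ranA (s, r) (y, x) /\
    proj (@prod_inner R Y X) ranA (s, r) = (y, x).
  apply: prod_projection => [|_ [S hS <-]].
    by exists (P (rank1 0 0)); [exact: HS_P | exact: A_P].
  have hPS : HS (P (rank1 0 0) - S) by apply: HS_sub => //; exact: HS_P.
  have -> : (y, x) - A S = A (P (rank1 0 0) - S).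
    by rewrite -(A_P _ HS00) /A (adjointB _ (HS_P _ HS00) hS).
  exact: residual_perp hPS.
have sbarE : sbar = y by rewrite /sbar projE.
have rbarE : rbar = x by rewrite /rbar projE.
have CE T : C T <-> HS T /\ A T = (y, x) by rewrite /C sbarE rbarE.
have CP T : HS T -> C (P T).
  by move=> hT; apply/CE; split; [exact: HS_P | exact: A_P].
split.
- by rewrite sbarE rbarE.
- apply/seteqP; split => T [hT]; first by case.
  by case=> Te Tf; split=> //; congr (_, _).
- by exists (P (rank1 0 0)); exact: CP.
move=> T hT.
have [projP PCE] : is_projection (@hs_inner R X Y B) C T (P T) /\ PC T = P T.
  apply: (hs_projection B_basis) => //; first exact: CP.
    by move=> S /CE[].
  move=> S /CE[_ AS]; move: (A_P T hT); rewrite -AS.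
  by case=> PTe PTf; split; apply/esym.
have PE := corrected_formula e f s r T.
split.
- by rewrite PCE.
- by move=> _ _; rewrite PCE [LHS]PE.
- move=> e0 _; rewrite PCE [LHS]PE e0 normr0 expr0n invr0 scale0r subr0.
  by rewrite /right_coef inner0l mul0r scale0r subr0.
- move=> _ f0; rewrite PCE [LHS]PE f0 normr0 expr0n invr0 scale0r subr0.
  by rewrite /left_coef inner0l mul0r scale0r subr0.
- move=> e0 f0; rewrite PCE [LHS]PE e0 f0.
  by rewrite !normr0 !expr0n !invr0 !scale0r !subr0.
Qed.
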